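(* Let $1\le p<n$, let $F_1,\ldots,F_p\in\mathbb{Q}[X_1,\ldots,X_n]$ be a reduced regular sequence generating the ideal of definition of the affine variety $S=\{F_1=\cdots=F_p=0\}\subset\mathbb{C}^n$, and suppose that $S$ is smooth. Let $1\le i\le n-p$ and let $a\in\mathbb{C}^{(n-p-i+1)\times n}$ be a matrix of rank $n-p-i+1$. Then (i) $W_{\underline{K}(\underline{a})}(S)\cap S_{reg}=\bigcup_{i\le j\le n-p}\Sigma^{(j)}(\pi_a)$; (ii) $\underline{\Delta}_i\cap S_{reg}=\bigcup_{i+1\le j\le n-p}\Sigma^{(j)}(\pi_a)$.
   Context: $J(F_1,\ldots,F_p)=[\partial F_k/\partial X_l]$ is the $p\times n$ Jacobian matrix. ''Reduced regular sequence'' means a regular sequence such that the ideals $(F_1,\ldots,F_k)$, $1\le k\le p$, are radical. $S_{reg}$ is the set of points of $S$ where $J(F_1,\ldots,F_p)$ has rank $p$; $S$ is smooth if $S=S_{reg}$. For a full-rank matrix $b\in\mathbb{C}^{(n-p-j+1)\times n}$, $1\le j\le n-p$, the $j$th classic polar variety $W_{\underline{K}(\underline{b})}(S)$ is the Zariski closure of the set of points of $S_{reg}$ at which all $(n-j+1)$-minors of $\begin{bmatrix}J(F_1,\ldots,F_p)\\ b\end{bmatrix}$ vanish. For $i<n-p$ put $\underline{\Delta}_i:=\bigcap_{1\le h\le n-p-i+1}W_{\underline{K}(\underline{a}^{(i,h)})}(S)$, where $a^{(i,h)}$ is the $(n-p-i)\times n$ matrix obtained from $a$ by deleting row $h$.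 For $i=n-p$ put $\underline{\Delta}_{n-p}:=\emptyset$. $\pi_a:S\to\mathbb{C}^{n-p-i+1}$ is the restriction to $S$ of the linear map $\mathbb{C}^n\to\mathbb{C}^{n-p-i+1}$ given by the matrix $a$, i.e. $x\mapsto a x^T$. For $x\in S$, $T_x$ is the Zariski tangent space of $S$ at $x$ and $d_x(\pi_a):T_x\to\mathbb{C}^{n-p-i+1}$ is the differential of $\pi_a$. For $i\le j\le n-p$ the Thom–Boardman stratum is $$\Sigma^{(j)}(\pi_a):=\{x\in S_{reg}\mid\dim_{\mathbb{C}}\ker d_x(\pi_a)=j\}.$$ *)

(* Defs.v *)
From HB Require Import structures.
From mathcomp Require Import all_boot all_order all_algebra.
From mathcomp Require Import mpoly complex.
From mathcomp Require Import boolp classical_sets reals.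

Set Implicit Arguments.
Unset Strict Implicit.
Unset Printing Implicit Defensive.

Import Order.TTheory GRing.Theory Num.Theory.
Local Open Scope ring_scope.
Local Open Scope classical_set_scope.

(** The field of complex numbers is [R[i]] for [R : realType];
    points of affine n-space are row vectors, and [x 0 : 'I_n -> K] is the
    coordinate function at which polynomials are evaluated. *)

(** With 0-based indices, [prefix_ideal F k] is the ideal generated by the
    first [k] members of the family [F]. *)
Definition prefix_ideal (A : comNzRingType) (p : nat) (F : 'I_p -> A)
    (k : nat) : set A :=
  [set G | exists c : 'I_p -> A, G = \sum_(l < p | (l < k)%N) c l * F l].

Definition radical_ideal (A : comNzRingType) (I : set A) : Prop :=
  forall (G : A) (m : nat), I (G ^+ m) -> I G.

Definition regular_sequence (A : comNzRingType) (p : nat) (F : 'I_p -> A) :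
    Prop :=
  ~ prefix_ideal F p 1 /\
  (forall (k : 'I_p) (G : A),
     prefix_ideal F k (G * F k) -> prefix_ideal F k G).

Definition reduced_regular_sequence (A : comNzRingType) (p : nat)
    (F : 'I_p -> A) : Prop :=
  regular_sequence F /\
  (forall k : nat, (1 <= k <= p)%N -> radical_ideal (prefix_ideal F k)).

Definition zero_locus (K : fieldType) (n : nat) (I : set {mpoly K[n]}) :
    set 'rV[K]_n :=
  [set x | forall G, I G -> G.@[x 0] = 0].

Definition vanishing_ideal (K : fieldType) (n : nat) (Z : set 'rV[K]_n) :
    set {mpoly K[n]} :=
  [set G | forall x, Z x -> G.@[x 0] = 0].

Definition zariski_closed (K : fieldType) (n : nat) (Z : set 'rV[K]_n) : Prop :=
  exists I : set {mpoly K[n]}, Z = zero_locus I.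

Definition zariski_closure (K : fieldType) (n : nat) (Z : set 'rV[K]_n) :
    set 'rV[K]_n :=
  smallest (@zariski_closed K n) Z.

Definition variety (K : fieldType) (n p : nat) (F : 'I_p -> {mpoly K[n]}) :
    set 'rV[K]_n :=
  zero_locus (range F).

Definition jacobian (K : fieldType) (n p : nat) (F : 'I_p -> {mpoly K[n]})
    (x : 'rV[K]_n) : 'M[K]_(p, n) :=
  \matrix_(k, l) (F k)^`M(l).@[x 0].

Definition regular_locus (K : fieldType) (n p : nat)
    (F : 'I_p -> {mpoly K[n]}) : set 'rV[K]_n :=
  [set x | variety F x /\ \rank (jacobian F x) = p].

Definition minors_vanish (K : fieldType) (m n : nat) (r : nat)
    (M : 'M[K]_(m, n)) : Prop :=
  forall (f : 'I_r -> 'I_m) (g : 'I_r -> 'I_n),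
    {homo f : i j / (i < j)%N} -> {homo g : i j / (i < j)%N} ->
    \det (mxsub f g M) = 0.

(** For the [j]-th polar variety, [b] has [m = n - p - j + 1] rows, so that
    [p + m = n - j + 1] is the size of the minors to be considered. *)
Definition polar_variety (K : fieldType) (n p m : nat)
    (F : 'I_p -> {mpoly K[n]}) (b : 'M[K]_(m, n)) : set 'rV[K]_n :=
  zariski_closure
    [set x | regular_locus F x /\
             minors_vanish (p + m) (col_mx (jacobian F x) b)].

(** Here [m = n - p - i] in [polar_variety], i.e. [j = i + 1]. *)
Definition Delta (K : fieldType) (n p i : nat) (F : 'I_p -> {mpoly K[n]})
    (a : 'M[K]_((n - p - i).+1, n)) : set 'rV[K]_n :=
  if (i < n - p)%N
  then \bigcap_(h : 'I_(n - p - i).+1) polar_variety F (row' h a)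
  else set0.

Definition tangent_space (K : fieldType) (n : nat) (S : set 'rV[K]_n)
    (x : 'rV[K]_n) : set 'rV[K]_n :=
  [set v | forall G, vanishing_ideal S G ->
             \sum_(l < n) G^`M(l).@[x 0] * v 0 l = 0].

(** A polynomial map is given by its coordinate polynomials. *)
Definition differential (K : fieldType) (n m : nat)
    (phi : 'I_m -> {mpoly K[n]}) (x v : 'rV[K]_n) : 'cV[K]_m :=
  jacobian phi x *m v^T.

Definition linear_map (K : fieldType) (m n : nat) (a : 'M[K]_(m, n)) :
    'I_m -> {mpoly K[n]} :=
  fun k => \sum_(l < n) a k l *: 'X_l.

Lemma linear_mapE (K : fieldType) (m n : nat) (a : 'M[K]_(m, n))
    (x : 'rV[K]_n) :
  \col_k (linear_map a k).@[x 0] = a *m x^T.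
Proof.
apply/colP => k; rewrite !mxE raddf_sum /=; apply: eq_bigr => l _.
by rewrite mevalZ mevalXU mxE.
Qed.

(** The kernel of the differential at [x] of the restriction to [S] of [phi]. *)
Definition ker_differential (K : fieldType) (n m : nat) (S : set 'rV[K]_n)
    (phi : 'I_m -> {mpoly K[n]}) (x : 'rV[K]_n) : set 'rV[K]_n :=
  [set v | tangent_space S x v /\ differential phi x v = 0].

Definition has_dim (K : fieldType) (vT : vectType K) (V : set vT) (d : nat) :
    Prop :=
  exists U : {vspace vT}, V = [set` U] /\ \dim U = d.

Definition thom_boardman (K : fieldType) (n p m : nat)
    (F : 'I_p -> {mpoly K[n]}) (a : 'M[K]_(m, n)) (j : nat) : set 'rV[K]_n :=
  [set x | regular_locus F x /\
           has_dim (ker_differential (variety F) (linear_map a) x) j].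

Definition complexify (R : realType) (n p : nat) (F : 'I_p -> {mpoly rat[n]}) :
    'I_p -> {mpoly R[i][n]} :=
  fun k => map_mpoly (@ratr R[i]) (F k).

(* Main.v *)
Require Import Defs.
From HB Require Import structures.
From mathcomp Require Import all_boot all_order all_algebra.
From mathcomp Require Import mpoly complex.
From mathcomp Require Import boolp classical_sets reals.

Set Implicit Arguments.
Unset Strict Implicit.
Unset Printing Implicit Defensive.

Import Order.TTheory GRing.Theory Num.Theory.
Local Open Scope ring_scope.
Local Open Scope classical_set_scope.

(** The generators F span the whole vanishing ideal, so T_x is the kernel of
    J(F)(x), and the kernel of the differential of pi_a at x has dimension
    n - rk [J; a].  Since S is smooth, the degeneracy locus defining a polar
    variety is already Zariski closed and no closure points are added; hence (i)
    is the equivalence rk [J; a] < n - i + 1 <-> n - rk [J; a] >= i.  For (ii), J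
    has independent rows, so if the rank of [J; a] is exactly one less than
    maximal, a linear relation between its rows must involve a row of a, which
    can be deleted without changing the rank. *)

(** The enumeration of [A] is a subsequence of the sorted enumeration of ['I_n]. This supplies the
    increasing column choices over which [minors_vanish] quantifies. *)
Lemma enum_val_homo_ltn (n : nat) (A : {pred 'I_n}) :
  {homo (@enum_val _ A) : i j / (i < j)%N}.
Proof.
move=> i j lt_ij; have x0 := enum_val i.
have srt : sorted ltn [seq val k | k <- enum A].
  have -> : enum A = [seq k <- enum 'I_n | k \in A].
    by rewrite /enum_mem -filter_predI; apply: eq_filter => k; rewrite /= andbT.
  apply: (subseq_sorted ltn_trans (s2 := [seq val k | k <- enum 'I_n])).
    by apply/map_subseq/filter_subseq.
  by rewrite val_enum_ord iota_ltn_sorted.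
rewrite !(enum_val_nth x0) -!(nth_map x0 (val x0) val) -?cardE //.
by apply: (sorted_ltn_nth ltn_trans) => //; rewrite inE size_map -cardE.
Qed.

Lemma minors_vanish_rank (K : fieldType) (r n : nat) (M : 'M[K]_(r, n)) :
  minors_vanish r M <-> (\rank M < r)%N.
Proof.
split=> [M0|rM f g _ _].
  rewrite ltn_neqAle rank_leq_row andbT; apply/negP => rM.
  have fullM : row_full M^T by rewrite /row_full mxrank_tr.
  pose h := fullrankfun fullM; pose A := [set h i | i : 'I_r]%SET.
  have cA : #|A| = r by rewrite card_imset ?card_ord //; apply: fullrankfun_inj.
  (* [h] need not be increasing: enumerate its image in increasing order. *)
  pose g (i : 'I_r) : 'I_n := enum_val (cast_ord (esym cA) i).
  have g_homo : {homo g : i j / (i < j)%N}.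
    by move=> i j ij; apply: enum_val_homo_ltn.
  have := M0 id g (fun _ _ => id) g_homo.
  apply/eqP; rewrite -det_tr -unitfE -[_ \is a _]/(_ \in unitmx) -row_full_unit.
  rewrite trmx_mxsub -sub1mx.
  (* The columns of [M] picked by [g] are those picked by [h], reordered, and the latter span the
     full space. *)
  apply: (submx_trans (B := rowsub h M^T)); first by rewrite sub1mx fullrowsub_full.
  apply/row_subP => i; have hiA : h i \in A by apply/imsetP; exists i.
  rewrite row_rowsub; have -> : h i = g (cast_ord cA (enum_rank_in hiA (h i))).
    by rewrite /g cast_ordK enum_rankK_in.
  by rewrite -(row_rowsub g) row_sub.
apply/eqP; apply: contraTT rM => det_neq0; rewrite -leqNgt.
have unitN : mxsub f g M \in unitmx by rewrite unitmxE unitfE.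
(* A submatrix is [M] multiplied on both sides by selection matrices, so its rank is at most that of
   [M]. *)
rewrite -[X in (X <= _)%N](mxrank_unit unitN) (_ : mxsub f g M = rowsub f 1%:M *m (M *m colsub g 1%:M)); last first.
  by rewrite mul_rowsub_mx mul1mx mulmx_colsub mulmx1 -mxsub_comp.
by apply: (leq_trans (mxrankM_maxr _ _)); apply: mxrankM_maxl.
Qed.

(** Full rank of the Jacobian is an open condition. Smoothness trades it for the equations [F], and
    the rank bound is the vanishing of minors, so the set is its own Zariski closure. *)
Lemma polar_variety_smooth (K : fieldType) (n p m : nat)
    (F : 'I_p -> {mpoly K[n]}) (b : 'M[K]_(m, n)) :
  variety F = regular_locus F ->
  polar_variety F b =
    [set x | regular_locus F x /\ (\rank (col_mx (jacobian F x) b) < p + m)%N].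
Proof.
move=> S_smooth; rewrite /polar_variety.
transitivity [set x | regular_locus F x /\
                      minors_vanish (p + m) (col_mx (jacobian F x) b)]; last first.
  by apply/seteqP; split=> x [Fx /minors_vanish_rank].
apply: smallest_id; rewrite -S_smooth.
(* [P] is the stacked matrix before evaluation at a point; its minors are the missing polynomial
   equations. *)
pose P : 'M[{mpoly K[n]}]_(p + m, n) :=
  col_mx (\matrix_(k, l) (F k)^`M(l)) (map_mx (@mpolyC n K) b).
have PE (x : 'rV_n) : map_mx (meval (x 0)) P = col_mx (jacobian F x) b.
  by rewrite map_col_mx; congr col_mx; apply/matrixP => k l; rewrite !mxE ?mevalC.
have minorE (x : 'rV_n) f g : (\det (mxsub f g P)).@[x 0] =
    \det (mxsub f g (col_mx (jacobian F x) b)) :> K.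
  by rewrite -det_map_mx map_mxsub PE.
exists (range F `|` [set G | exists (f : 'I_(p + m) -> 'I_(p + m)) (g : 'I_(p + m) -> 'I_n),
  [/\ {homo f : i j / (i < j)%N}, {homo g : i j / (i < j)%N}
    & G = \det (mxsub f g P)]]).
apply/seteqP; split=> x /=.
  case=> Fx minors0 G [FG|[f [g [hf hg ->]]]]; first exact: Fx.
  by rewrite minorE minors0.
move=> x0; split=> [G FG|f g hf hg]; first by apply: x0; left.
by rewrite -minorE; apply: x0; right; exists f, g.
Qed.

(** By the Leibniz rule, the differential of a combination of the [F k] at a point of the variety is
    a combination of their differentials: the terms carrying the value of [F k] vanish. *)
Lemma tangent_space_ker (K : fieldType) (n p : nat) (F : 'I_p -> {mpoly K[n]})
    (x : 'rV[K]_n) :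
  prefix_ideal F p = vanishing_ideal (variety F) -> variety F x ->
  tangent_space (variety F) x = [set v | jacobian F x *m v^T = 0].
Proof.
move=> F_gen Sx; apply/seteqP; split=> v /= Tv.
  have IFk k : vanishing_ideal (variety F) (F k) by move=> y; apply; exists k.
  apply/colP => k; rewrite !mxE -[RHS](Tv _ (IFk k)).
  by apply: eq_bigr => l _; rewrite !mxE.
move=> G; rewrite -F_gen => -[c ->].
have F0 k : (F k).@[x 0] = 0 by apply: Sx; exists k.
transitivity (\sum_(k < p | (k < p)%N)
    (c k).@[x 0] * (jacobian F x *m v^T) k 0); last first.
  by apply: big1 => k _; rewrite Tv mxE mulr0.
under [RHS]eq_bigr => k _ do rewrite mxE mulr_sumr.
rewrite exchange_big /=; apply: eq_bigr => l _.
rewrite (raddf_sum (mderiv l)) (raddf_sum (meval (x 0))) mulr_suml.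
apply: eq_bigr => k _.
by rewrite /= mderivM mevalD !mevalM F0 mulr0 add0r !mxE mulrA.
Qed.

Lemma jacobian_linear_map (K : fieldType) (m n : nat) (a : 'M[K]_(m, n))
    (x : 'rV[K]_n) : jacobian (linear_map a) x = a.
Proof.
apply/matrixP => k l; rewrite mxE (raddf_sum (mderiv l)) (raddf_sum (meval (x 0))) /=.
rewrite (bigD1 l) //= big1.
  rewrite addr0 mderivZ mderivX mnmE eqxx !mevalZ.
  have -> : (U_(l) - U_(l))%MM = 0%MM :> 'X_{1..n}.
    by apply/mnmP => j; rewrite mnmBE subnn mnm0E.
  by rewrite mpolyX0 meval1 !mulr1.
by move=> j jl; rewrite mderivZ mderivX mnmE (negPf jl) scale0r scaler0 meval0.
Qed.

(** Up to transposition the solution set is the left kernel of [M^T], and the rows of a basis of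
    that kernel form a free tuple spanning it. *)
Lemma has_dim_ker (K : fieldType) (m n d : nat) (M : 'M[K]_(m, n)) :
  has_dim [set v : 'rV[K]_n | M *m v^T = 0] d <-> d = (n - \rank M)%N.
Proof.
pose B := row_base (kermx M^T); pose t := [tuple row k B | k < \rank (kermx M^T)].
have tE (k : 'I_(\rank (kermx M^T))) : t`_k = row k B by rewrite -tnth_nth tnth_mktuple.
have free_t : free t.
  apply/freeP => c c0 k; pose u := \row_j c j.
  have : u *m B = 0 *m B.
    by rewrite mul0mx mulmx_sum_row -[RHS]c0; apply: eq_bigr => j _; rewrite tE mxE.
  by move/(row_free_inj (row_base_free _))/rowP/(_ k); rewrite !mxE.
have spanE : [set v : 'rV[K]_n | M *m v^T = 0] = [set` <<t>>%VS].
  apply/seteqP; split=> v /=.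
    move=> /(congr1 trmx); rewrite trmx_mul trmxK trmx0 => /sub_kermxP.
    rewrite -(eq_row_base (kermx _)) => /submxP[u ->].
    rewrite mulmx_sum_row; apply: memv_suml => k _; apply: memvZ.
    by apply: memv_span; rewrite -tE mem_nth // size_tuple.
  move=> /(coord_span (X := t)) ->; apply: trmx_inj; rewrite trmx_mul trmxK trmx0.
  apply/sub_kermxP; apply: summx_sub => k _; apply: scalemx_sub.
  by rewrite tE -(eq_row_base (kermx _)) row_sub.
have dimt : \dim <<t>>%VS = (n - \rank M)%N.
  by rewrite (eqP free_t) size_tuple mxrank_ker mxrank_tr.
(* A subspace is determined by its set of elements, so the dimension in [has_dim] is unique. *)
split=> [[U [UE <-]]|->]; last by exists <<t>>%VS.
rewrite -dimt; congr (\dim _); apply/vspaceP => v.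
by apply/idP/idP => Uv; [have : [set` <<t>>%VS] v | have : [set` U] v];
  rewrite // -?UE ?spanE // -spanE UE.
Qed.

(** The bound [p + m] is the number of rows after a deletion, but one less than that of
    [col_mx J a]: a defect of one on the left matches a defect of two on the right. *)
Lemma rank_delete_row (K : fieldType) (p m n : nat) (J : 'M[K]_(p, n))
    (a : 'M[K]_(m.+1, n)) :
  row_free J ->
  (forall h, (\rank (col_mx J (row' h a)) < p + m)%N) <->
  (\rank (col_mx J a) < p + m)%N.
Proof.
move=> freeJ; split=> [delJ|rJ h]; last first.
  apply: leq_ltn_trans rJ; apply: mxrankS; rewrite -!addsmxE addsmxS //.
  by apply/row_subP => k; rewrite row_rowsub row_sub.
have subJ h : (J <= col_mx J (row' h a))%MS by rewrite -addsmxE addsmxSl.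
have suba h k : k != h -> (row k a <= col_mx J (row' h a))%MS.
  case: (unliftP h k) => [k' ->|->] kh; last by rewrite eqxx in kh.
  rewrite -(row_rowsub (lift h)) -addsmxE.
  by apply: submx_trans (addsmxSr _ _); apply: row_sub.
rewrite ltnNge; apply/negP => rJ.
(* If all [p + m + 1] rows are independent, deleting one lowers the rank by only one, against
   [delJ]. *)
have [freeJa|nfree] := boolP (row_free (col_mx J a)).
  have := delJ ord0; rewrite ltnNge => /negP; apply.
  have rkJa : \rank (col_mx J a) = (p + m).+1 by rewrite (eqP freeJa) addnS.
  rewrite -ltnS -rkJa -[X in (_ <= X)%N]addn1.
  apply: leq_trans (leq_add (leqnn _) (rank_leq_row (row ord0 a))).
  apply: leq_trans (mxrank_adds_leqif _ _); apply: mxrankS.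
  rewrite col_mx_sub (submx_trans (subJ ord0) (addsmxSl _ _)) /=.
  apply/row_subP => k; have [->|k0] := eqVneq k ord0; first exact: addsmxSr.
  exact: submx_trans (suba _ _ k0) (addsmxSl _ _).
(* A relation with nonzero coefficient at row [h] of [a] puts that row in the span of the others, so
   deleting it keeps the rank at least [p + m]. *)
suff [u uJa [h uh]] : exists2 u : 'rV[K]_(p + m.+1),
    u *m col_mx J a = 0 & exists h, rsubmx u 0 h != 0.
  have ha : (row h a <= col_mx J (row' h a))%MS.
    move: uJa; rewrite -{1}[u]hsubmxK mul_row_col (mulmx_sum_row _ a) (bigD1 h) //=.
    rewrite addrCA => /eqP; rewrite addr_eq0 => /eqP uE.
    rewrite -[row h a](scalerK uh) uE scalemx_sub // eqmx_opp addmx_sub //.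
      exact: submx_trans (submxMl _ _) (subJ h).
    by apply: summx_sub => k kh; apply: scalemx_sub; apply: suba.
  move: rJ; rewrite leqNgt => /negP; apply; apply: leq_ltn_trans (delJ h).
  apply: mxrankS; rewrite col_mx_sub subJ /=.
  by apply/row_subP => k; have [->|/suba] := eqVneq k h.
have [u uJa u0] : exists2 u : 'rV[K]_(p + m.+1), u *m col_mx J a = 0 & u != 0.
  apply: contrapT => noU; move/negP: nfree; apply; apply: inj_row_free => u uJa.
  by apply/eqP; apply: contrapT => /negP u0; apply: noU; exists u.
(* A relation not involving [a] would be one among the independent rows of [J], hence trivial. *)
exists u => //; apply: contrapT => noh.
have u2 : rsubmx u = 0.
  apply/rowP => h; rewrite [RHS]mxE; apply/eqP; apply: contrapT => /negP uh.
  by apply: noh; exists h.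
move: uJa; rewrite -{1}[u]hsubmxK mul_row_col u2 mul0mx addr0.
rewrite -[0](mul0mx _ J) => /(row_free_inj freeJ) u1.
by move: u0; rewrite -[u]hsubmxK u1 u2 row_mx0 eqxx.
Qed.

(** The kernel of the differential is the intersection of the kernels of the Jacobian and of [a],
    that is, the kernel of the stacked matrix. *)
Lemma thom_boardmanE (K : fieldType) (n p m j : nat) (F : 'I_p -> {mpoly K[n]})
    (a : 'M[K]_(m, n)) :
  prefix_ideal F p = vanishing_ideal (variety F) ->
  thom_boardman F a j =
    [set x | regular_locus F x /\ j = (n - \rank (col_mx (jacobian F x) a))%N].
Proof.
move=> F_gen.
have kerE x : variety F x -> ker_differential (variety F) (linear_map a) x =
    [set v | col_mx (jacobian F x) a *m v^T = 0].
  move=> Sx; rewrite /ker_differential tangent_space_ker //.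
  apply/seteqP; split=> v /=; rewrite /differential jacobian_linear_map mul_col_mx.
    by case=> -> ->; rewrite col_mx0.
  by rewrite -[0 in X in X -> _]col_mx0 => /eq_col_mx.
apply/seteqP; split=> x [Fx dimx]; split=> //; have [Sx _] := Fx.
  by apply/has_dim_ker; rewrite -kerE.
by rewrite kerE //; apply/has_dim_ker.
Qed.

Theorem lemma11 (R : realType) (n p i : nat) (F : 'I_p -> {mpoly rat[n]})
    (a : 'M[R[i]]_((n - p - i).+1, n))
    (hp : (1 <= p)%N) (hpn : (p < n)%N)
    (F_reduced_regular : reduced_regular_sequence F)
    (F_generates : prefix_ideal (complexify R F) p =
                   vanishing_ideal (variety (complexify R F)))
    (S_smooth : variety (complexify R F) = regular_locus (complexify R F))
    (hi : (1 <= i <= n - p)%N)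
    (a_full_rank : \rank a = (n - p - i).+1) :
  polar_variety (complexify R F) a `&` regular_locus (complexify R F) =
    \bigcup_(j in [set j : nat | (i <= j <= n - p)%N])
      thom_boardman (complexify R F) a j
  /\
  Delta (complexify R F) a `&` regular_locus (complexify R F) =
    \bigcup_(j in [set j : nat | (i.+1 <= j <= n - p)%N])
      thom_boardman (complexify R F) a j.
Proof.
set G := complexify R F in F_generates S_smooth *.
(* The bound on [k] keeps the truncated subtraction [n - k] faithful. *)
have strataE k : (k <= n)%N ->
    \bigcup_(j in [set j : nat | (k <= j <= n - p)%N]) thom_boardman G a j =
    [set x | regular_locus G x /\
             (\rank (col_mx (jacobian G x) a) <= n - k)%N].
  move=> kn; apply/seteqP; split=> [x [j /= /andP[kj _]]|x [Gx rx]].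
    rewrite thom_boardmanE // => -[Gx jE]; split=> //.
    by rewrite leq_subRL // addnC -leq_subRL ?rank_leq_col // -jE.
  exists (n - \rank (col_mx (jacobian G x) a))%N; last by rewrite thom_boardmanE.
  rewrite /= leq_subRL ?rank_leq_col // addnC -leq_subRL // rx /=.
  (* The upper end [n - p] of the range is automatic: the stacked matrix has rank at least that of
     the Jacobian, which is [p]. *)
  apply: leq_sub2l; have [_ rJ] := Gx; rewrite -[X in (X <= _)%N]rJ.
  by apply: mxrankS; rewrite -addsmxE addsmxSl.
have [i_gt0 i_le] := andP hi.
have i_le_n : (i <= n)%N := leq_trans i_le (leq_subr _ _).
have pE : (p + (n - p - i) = n - i)%N.
  by rewrite subnAC subnKC // leq_subRL // addnC -leq_subRL // ltnW.
split.
  rewrite strataE // polar_variety_smooth //.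
  have rank_ltE x : (\rank (col_mx (jacobian G x) a) < p + (n - p - i).+1)%N =
      (\rank (col_mx (jacobian G x) a) <= n - i)%N.
    by rewrite [X in (_ < X)%N]addnS ltnS pE.
  by apply/seteqP; split=> x /=; rewrite rank_ltE => -[]; [case|].
(* When [i = n - p], both sides are empty, the right one because its index range is. *)
rewrite /Delta; case: ltnP => [i_lt|n_le]; last first.
  rewrite set0I; apply/esym; rewrite -subset0 => x [j /= /andP[ij jn] _].
  by move: (leq_trans ij jn); rewrite ltnNge n_le.
rewrite strataE; last by apply: leq_trans i_lt (leq_subr _ _).
have i_lt_n : (i < n)%N := leq_trans i_lt (leq_subr _ _).
(* Starting the union at [i + 1] gives exactly the threshold of [rank_delete_row] with
   [m = n - p - i]. *)
have rank_leE x : (\rank (col_mx (jacobian G x) a) <= n - i.+1)%N =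
    (\rank (col_mx (jacobian G x) a) < p + (n - p - i))%N.
  by rewrite pE subnS -ltnS prednK // subn_gt0.
apply/seteqP; split=> x /=; rewrite rank_leE.
  case=> Dx Gx; split=> //; apply/rank_delete_row; first by apply/eqP; case: Gx.
  by move=> h; have := Dx h I; rewrite polar_variety_smooth // => -[].
case=> Gx rx; split=> // h _; rewrite polar_variety_smooth //; split=> //.
have freeJ : row_free (jacobian G x) by apply/eqP; case: Gx.
exact: (rank_delete_row a freeJ).2.
Qed.
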